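(* Let $K_4^-$ be the $3$-graph on $4$ vertices with exactly $3$ edges and $F_{3,2}$ the $3$-graph on $\{1,\dots,5\}$ with edges $123,124,125,345$. Then \[\pi_{K_4^-}(\{F_{3,2}\})=\frac{27}{64}.\]
   Context: A $3$-graph is a pair $G=(V,E)$ with $E$ a set of $3$-element subsets of $V$. For a $3$-graph $H$ on $h$ vertices and a $3$-graph $G$ on $n\ge h$ vertices, $e_H(G)$ is the number of $h$-subsets of $V(G)$ inducing a subgraph isomorphic to $H$. For a family $\mathcal{F}$ of $3$-graphs, $G$ is $\mathcal{F}$-free if it contains no member of $\mathcal{F}$ as a (not necessarily induced) subgraph. $\mathrm{ex}_H(n,\mathcal{F})$ is the maximum of $e_H(G)$ over $\mathcal{F}$-free $G$ on $n$ vertices, and $\pi_H(\mathcal{F})=\lim_{n\to\infty}\mathrm{ex}_H(n,\mathcal{F})/\binom{n}{h}$ (the limit exists). *)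

(* Defs.v *)
From HB Require Import structures.
From mathcomp Require Import all_boot all_order all_algebra.
From mathcomp Require Import all_classical all_reals all_analysis.

Set Implicit Arguments.
Unset Strict Implicit.
Unset Printing Implicit Defensive.

Import Order.TTheory GRing.Theory Num.Theory.
Import numFieldNormedType.Exports.

Local Open Scope classical_set_scope.
Local Open Scope ring_scope.

Record graph3 (V : finType) := Graph3 {
  edges :> {set {set V}};
  edges_card3 : [forall e in edges, #|e| == 3%N]
}.

HB.instance Definition _ (V : finType) := [isSub for @edges V].
HB.instance Definition _ (V : finType) := [Finite of graph3 V by <:].

(* A finite 3-graph packed with its vertex set, so that a family may contain
   3-graphs on different vertex sets. *)
Record fgraph3 := FGraph3 {
  verts : finType;
  graph_of :> graph3 verts
}.

(* [classical_sets.set] is too low in the universe hierarchy for [fgraph3], which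
   quantifies over [finType]; hence plain predicates. *)
Definition fgraph3_family := fgraph3 -> Prop.

Definition singleton_family (H : fgraph3) : fgraph3_family := fun H' => H' = H.

Section Counting.
Variables (H : fgraph3) (V : finType) (G : graph3 V).

(* The subgraph of G induced by S is isomorphic to H: f is the isomorphism,
   seen as an injection of V(H) into V(G) with image S. *)
Definition induces (S : {set V}) : bool :=
  [exists f : {ffun verts H -> V},
    [&& injectiveb f, f @: [set: verts H]%SET == S &
        [forall e : {set verts H}, (e \in edges H) == (f @: e \in edges G)]]].

Definition e_count : nat :=
  #|[set S : {set V} | (#|S| == #|verts H|) && induces S]%SET|.

Definition contains_subgraph : Prop :=
  exists f : verts H -> V,
    injective f /\ forall e, e \in edges H -> f @: e \in edges G.

End Counting.

Definition free_of (F : fgraph3_family) (V : finType) (G : graph3 V) : Prop :=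
  forall H, F H -> ~ contains_subgraph H G.

(* [e_count] and [free_of] are invariant under isomorphism of G, so the 3-graphs
   on n vertices are represented by those with vertex set 'I_n. *)
Definition ex_num (H : fgraph3) (n : nat) (F : fgraph3_family) : nat :=
  \max_(G : graph3 'I_n | `[< free_of F G >]) e_count H G.

Definition ex_ratio (R : realType) (H : fgraph3) (F : fgraph3_family) : R^nat :=
  fun n => (ex_num H n F)%:R / 'C(n, #|verts H|)%:R.

Definition turan_density (R : realType) (H : fgraph3) (F : fgraph3_family) : R :=
  limn (ex_ratio R H F).

Definition triple (n i j k : nat) : {set 'I_n.+1} :=
  [set inord i; inord j; inord k]%SET.

Lemma card_triple (n i j k : nat) :
  (i < j)%N -> (j < k)%N -> (k <= n)%N -> #|triple n i j k| = 3%N.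
Proof.
move=> ij jk kn; have jn := leq_trans (ltnW jk) kn.
have i_n := leq_trans (ltnW ij) jn.
rewrite /triple -finset.setUA cardsU1 cards2 !inE -!val_eqE /= !inordK //.
by rewrite !ltn_eqF ?(ltn_trans ij jk).
Qed.

Definition K4minus_edges : {set {set 'I_4}} :=
  [set triple 3 0 1 2; triple 3 0 1 3; triple 3 0 2 3]%SET.

Lemma K4minus_card3 : [forall e in K4minus_edges, #|e| == 3%N].
Proof.
apply/forall_inP => e; rewrite !inE.
by move=> /orP[/orP[]|] /eqP ->; rewrite card_triple.
Qed.

Definition K4minus : fgraph3 := FGraph3 (Graph3 K4minus_card3).

(* The vertex i of {1, ..., 5} is represented by i - 1 in 'I_5. *)
Definition F32_edges : {set {set 'I_5}} :=
  [set triple 4 0 1 2; triple 4 0 1 3; triple 4 0 1 4; triple 4 2 3 4]%SET.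

Lemma F32_card3 : [forall e in F32_edges, #|e| == 3%N].
Proof.
apply/forall_inP => e; rewrite !inE.
by move=> /orP[/orP[/orP[]|]|] /eqP ->; rewrite card_triple.
Qed.

Definition F32 : fgraph3 := FGraph3 (Graph3 F32_card3).

(* Main.v *)
Require Import Defs.
From Stdlib Require Import ZArith.
From HB Require Import structures.
From mathcomp Require Import all_boot all_order all_algebra.
From mathcomp Require Import all_classical all_reals all_analysis.
From mathcomp Require Import ssrZ zify lra.

(** The lower bound comes from a vertex partition A, B with |A| about n/4 and
    all triples meeting A in exactly one vertex: an apex in A and three vertices
    in B span a K4^-, and 4 (1/4) (3/4)^3 = 27/64.

    The upper bound is a flag algebra argument.  Every pair of vertices of F32
    lies in an edge, so F32-freeness passes to pullbacks along arbitrary maps,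
    and one may average over all 6-tuples of vertices, repetitions included.
    Let g, h (rooted at a pair xy) and u (rooted at an edge xyz) be the integer
    combinations [gflag], [hflag], [uflag] of induced flags; the coefficients
    come from a semidefinite program and make the mean of each flag vanish in the
    extremal construction.  With primes denoting independent copies, averaging
      162 - 384 [K4^- on 4 of the points] - 2 g g' - 5 h h' - 32 [xyz edge] u u'
    over the 720 orderings of a 6-point F32-free 3-graph always gives a
    nonnegative number; this is a finite computation.  Summed over all 6-tuples,
    the last three products become sums of squares, so the K4^- density is at
    most 162/384 = 27/64. *)

Set Implicit Arguments.
Unset Strict Implicit.
Unset Printing Implicit Defensive.

Import Order.TTheory GRing.Theory Num.Theory.
Import numFieldNormedType.Exports.

Delimit Scope Z_scope with BZ.

(** * Flags on at most four vertices and their symmetries *)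

Section Flags.
Variables (T : Type) (E : T -> T -> T -> bool).

Definition kflag x y z w : Z :=
  match E x y z, E x y w, E x z w, E y z w with
  | true, true, true, false | true, true, false, true
  | true, false, true, true | false, true, true, true => 1
  | _, _, _, _ => 0
  end%BZ.

Definition gflag x y z w : Z :=
  match E x y z, E x y w, E x z w, E y z w with
  | false, false, false, false => -9
  | true, true, false, false => 9
  | false, false, true, true => 7
  | true, false, true, true | false, true, true, true => 12
  | true, true, true, false | true, true, false, true => 7
  | true, false, true, false | true, false, false, true
  | false, true, true, false | false, true, false, true => -9
  | _, _, _, _ => 0
  end%BZ.

Definition hflag x y z w : Z :=
  match E x y z, E x y w, E x z w, E y z w with
  | true, true, true, false | true, true, false, true => 2
  | true, false, true, false | true, false, false, true
  | false, true, true, false | false, true, false, true => -3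
  | _, _, _, _ => 0
  end%BZ.

Definition uflag x y z w : Z :=
  match E x y w, E x z w, E y z w with
  | true, false, false => 3
  | false, true, false => -3
  | true, false, true => 1
  | false, true, true => -1
  | _, _, _ => 0
  end%BZ.

Definition pair_term (s : seq T) : Z :=
  if s is [:: x; y; z; w; z'; w'] then
    (162 - 384 * kflag z w z' w' - 2 * (gflag x y z w * gflag x y z' w')
      - 5 * (hflag x y z w * hflag x y z' w'))%BZ
  else 0%BZ.

(** The sixth point is a dummy, so that both terms are summed over 6-tuples. The coefficient 8 is
    32/4: [sym_term] restores the factor 4, which also makes up for this term having 4 symmetries
    where [pair_term] has 16. *)
Definition edge_term (s : seq T) : Z :=
  if s is [:: x; y; z; w; w'; _] then
    if E x y z then (8 * (uflag x y z w * uflag x y z w'))%BZ else 0%BZ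
  else 0%BZ.

Definition has_F32 (s : seq T) : bool :=
  if s is [:: x, y, z, w, v & _] then [&& E x y z, E x y w, E x y v & E z w v]
  else false.

(** [rel_free] ranges over lists with repetitions too, so it forbids homomorphic images of F32. This
    makes the condition stable under pullback along maps that are not injective. *)
Record F32_free_rel : Prop := F32FreeRel {
  rel_swap12 : forall x y z, E x y z = E y x z;
  rel_swap23 : forall x y z, E x y z = E x z y;
  rel_irr : forall x y, E x x y = false;
  rel_free : forall s, has_F32 s = false
}.

Hypothesis E_free : F32_free_rel.

Let E12 := rel_swap12 E_free.
Let E23 := rel_swap23 E_free.

Lemma gflag_swap12 x y z w : gflag y x z w = gflag x y z w.
Proof.
rewrite /gflag (E12 y x z) (E12 y x w).
by case: (E x y z); case: (E x y w); case: (E x z w); case: (E y z w).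
Qed.

Lemma gflag_swap34 x y z w : gflag x y w z = gflag x y z w.
Proof.
rewrite /gflag (E23 x w z) (E23 y w z).
by case: (E x y z); case: (E x y w); case: (E x z w); case: (E y z w).
Qed.

Lemma hflag_swap12 x y z w : hflag y x z w = hflag x y z w.
Proof.
rewrite /hflag (E12 y x z) (E12 y x w).
by case: (E x y z); case: (E x y w); case: (E x z w); case: (E y z w).
Qed.

Lemma hflag_swap34 x y z w : hflag x y w z = hflag x y z w.
Proof.
rewrite /hflag (E23 x w z) (E23 y w z).
by case: (E x y z); case: (E x y w); case: (E x z w); case: (E y z w).
Qed.

Lemma kflag_swap12 x y z w : kflag y x z w = kflag x y z w.
Proof.
rewrite /kflag (E12 y x z) (E12 y x w).
by case: (E x y z); case: (E x y w); case: (E x z w); case: (E y z w).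
Qed.

Lemma kflag_swap34 x y z w : kflag x y w z = kflag x y z w.
Proof.
rewrite /kflag (E23 x w z) (E23 y w z).
by case: (E x y z); case: (E x y w); case: (E x z w); case: (E y z w).
Qed.

Lemma kflag_swap_pairs x y z w : kflag z w x y = kflag x y z w.
Proof.
rewrite /kflag (E23 z w x) (E12 z x w) (E23 x z w) (E23 z w y) (E12 z y w)
  (E23 y z w) (E12 z x y) (E23 x z y) (E12 w x y) (E23 x w y) (E23 y w z)
  (E23 x w z).
by case: (E x y z); case: (E x y w); case: (E x z w); case: (E y z w).
Qed.

Lemma uflag_swap23 x y z w : uflag x z y w = (- uflag x y z w)%BZ.
Proof.
rewrite /uflag (E12 z y w).
by case: (E x y w); case: (E x z w); case: (E y z w).
Qed.

End Flags.

Arguments F32_free_rel {T} E.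

(** * Permutations as sequences, with [arr] as composition *)

Definition perms n := permutations (iota 0 n).

Definition arr (s t : seq nat) : seq nat := [seq nth 0 s i | i <- t].

Section Perms.
Variable n : nat.

Lemma mem_perms s : (s \in perms n) = perm_eq s (iota 0 n).
Proof. by rewrite mem_permutations. Qed.

Lemma perms_size s : s \in perms n -> size s = n.
Proof. by rewrite mem_perms => /perm_size ->; rewrite size_iota. Qed.

Lemma perms_uniq s : s \in perms n -> uniq s.
Proof. by rewrite mem_perms => /perm_uniq ->; rewrite iota_uniq. Qed.

Lemma perms_mem s i : s \in perms n -> (i \in s) = (i < n).
Proof. by rewrite mem_perms => /perm_mem ->; rewrite mem_iota. Qed.

Lemma arr_perms s t : s \in perms n -> t \in perms n -> arr s t \in perms n.
Proof.
move=> ss st; rewrite mem_perms /arr.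
have := st; rewrite mem_perms => /(perm_map (nth 0 s))/perm_trans -> //.
by rewrite -{1}(perms_size ss) map_nth_iota0 // take_size -mem_perms.
Qed.

Lemma arr_inj_l s : s \in perms n -> {in perms n &, injective (arr s)}.
Proof.
move=> ss t t' st st'; rewrite /arr => eq_st.
apply: (@eq_from_nth _ 0); first by rewrite (perms_size st) (perms_size st').
move=> i; rewrite (perms_size st) => ltin.
have := congr1 (nth 0 ^~ i) eq_st.
rewrite !(nth_map 0) ?(perms_size st) ?(perms_size st') // => /eqP.
have nth_lt r : r \in perms n -> nth 0 r i < n.
  by move=> rP; rewrite -(perms_mem _ rP) mem_nth ?(perms_size rP).
by rewrite nth_uniq ?(perms_size ss) ?(perms_uniq ss) ?nth_lt // => /eqP.
Qed.

Lemma arr_inj_r t : t \in perms n -> {in perms n &, injective (arr ^~ t)}.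
Proof.
move=> st s s' ss ss'; rewrite /arr => /eq_in_map eq_st.
apply: (@eq_from_nth _ 0); first by rewrite (perms_size ss) (perms_size ss').
by move=> i; rewrite (perms_size ss) => ltin; apply: eq_st; rewrite perms_mem.
Qed.

Lemma perm_perms f : {in perms n, forall s, f s \in perms n} ->
  {in perms n &, injective f} -> perm_eq [seq f s | s <- perms n] (perms n).
Proof.
move=> fP f_inj; apply: uniq_perm; rewrite ?map_inj_in_uniq //;
  rewrite ?permutations_uniq //.
have u: uniq [seq f s | s <- perms n].
  by rewrite map_inj_in_uniq ?permutations_uniq.
have sub : {subset [seq f s | s <- perms n] <= perms n}.
  by move=> _ /mapP[s ss ->]; exact: fP.
by have [] := uniq_min_size u sub; rewrite size_map.
Qed.

End Perms.

(** * Reducing sums over orderings by symmetry *)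

Definition lt_at (i j : nat) (s : seq nat) := nth 0 s i < nth 0 s j.

Section Symmetrize.
Local Open Scope ring_scope.
Variables (n : nat) (M : zmodType).

Lemma sum_perms_arr_l (F : seq nat -> M) t : t \in perms n ->
  \sum_(s <- perms n) F (arr t s) = \sum_(s <- perms n) F s.
Proof.
move=> tP; rewrite -[RHS](perm_big _ (perm_perms _ (arr_inj_l tP))) ?big_map //.
by move=> s; exact: arr_perms.
Qed.

(** Composing with [t] exchanges the entries at [i] and [j], so it maps the orderings with
    [s_i < s_j] bijectively onto those with [s_j < s_i]; ties cannot occur. Both halves thus have
    the same sum. *)
Lemma sum_perms_half (F : seq nat -> M) (P : pred (seq nat)) t i j :
    perm_eq t (iota 0 n) -> (i < n)%N -> (j < n)%N -> i != j ->
    nth 0%N t i = j -> nth 0%N t j = i ->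
    {in perms n, forall s, F (arr s t) = F s} ->
    {in perms n, forall s, P (arr s t) = P s} ->
  \sum_(s <- perms n | P s) F s =
  (\sum_(s <- perms n | P s && lt_at i j s) F s) *+ 2.
Proof.
rewrite -mem_perms => tP ltin ltjn neqij ti tj Ft Pt.
rewrite (bigID (lt_at i j)) /= mulr2n; congr (_ + _).
rewrite -(perm_big _ (perm_perms _ (arr_inj_r tP))) ?big_map /=; last first.
  by move=> s sP; exact: arr_perms.
rewrite big_seq_cond [RHS]big_seq_cond; apply: eq_big => [s|s /andP[sP _]].
  case sP: (s \in _) => //=; rewrite Pt // /lt_at /arr !(nth_map 0%N)
    ?(perms_size tP) // ti tj -leqNgt leq_eqVlt.
  by rewrite nth_uniq ?(perms_size sP) ?(perms_uniq sP) // (negPf neqij).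
exact: Ft.
Qed.

End Symmetrize.

Lemma perms6P s : s \in perms 6 ->
  exists a b c d a' b', s = [:: a; b; c; d; a'; b'].
Proof.
move/perms_size; case: s => [|a [|b [|c [|d [|a' [|b' [|? ?]]]]]]] //= _.
by exists a, b, c, d, a', b'.
Qed.

Section ReducedSum.
Local Open Scope ring_scope.
Variable e : nat -> nat -> nat -> bool.
Hypothesis e_free : F32_free_rel e.

(** One ordering per orbit of the symmetries of each term: 45 and 180 out of 720. The nested
    conjunctions starting at [predT] have the shape that iterating [sum_perms_half] produces. *)
Definition pair_perms := [seq s <- perms 6 |
  (((predT s && lt_at 0 1 s) && lt_at 2 3 s) && lt_at 4 5 s) && lt_at 2 4 s].
Definition edge_perms := [seq s <- perms 6 |
  (predT s && lt_at 1 2 s) && lt_at 3 4 s].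

Definition sym_term : Z :=
  \sum_(s <- perms 6) (pair_term e s - edge_term e s *+ 4).

Lemma sum_pair_term : \sum_(s <- perms 6) pair_term e s =
  (\sum_(s <- pair_perms) pair_term e s) *+ 16.
Proof.
rewrite big_filter.
rewrite (@sum_perms_half 6 Z _ predT [:: 1; 0; 2; 3; 4; 5]%N 0 1) //;
  last 1 first.
- move=> s /perms6P[a [b [c [d [a' [b' ->]]]]]] /=.
  by rewrite !(gflag_swap12 e_free a b) !(hflag_swap12 e_free a b).
rewrite (@sum_perms_half 6 Z _ _ [:: 0; 1; 3; 2; 4; 5]%N 2 3) //;
  last 1 first.
- move=> s /perms6P[a [b [c [d [a' [b' ->]]]]]] /=.
  by rewrite (gflag_swap34 e_free _ _ c) (hflag_swap34 e_free _ _ c)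
    (kflag_swap12 e_free c).
rewrite (@sum_perms_half 6 Z _ _ [:: 0; 1; 2; 3; 5; 4]%N 4 5) //;
  last 1 first.
- move=> s /perms6P[a [b [c [d [a' [b' ->]]]]]] /=.
  by rewrite (gflag_swap34 e_free _ _ a') (hflag_swap34 e_free _ _ a')
    (kflag_swap34 e_free _ _ a').
(* Exchanging the two copies [zw] and [z'w'] also moves positions 3 and 5; it swaps the conditions
   already imposed at 2, 3 and at 4, 5, so their conjunction is preserved. *)
rewrite (@sum_perms_half 6 Z _ _ [:: 0; 1; 4; 5; 2; 3]%N 2 4) //;
  last 2 first.
- move=> s /perms6P[a [b [c [d [a' [b' ->]]]]]] /=.
  by rewrite (kflag_swap_pairs e_free c) (Z.mul_comm (gflag _ _ _ a' _))
    (Z.mul_comm (hflag _ _ _ a' _)).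
- move=> s /perms6P[a [b [c [d [a' [b' ->]]]]]]; rewrite /lt_at /=.
  by rewrite -!andbA; congr (_ && _); rewrite andbC.
by rewrite -!mulrnA.
Qed.

Lemma sum_edge_term : \sum_(s <- perms 6) edge_term e s =
  (\sum_(s <- edge_perms) edge_term e s) *+ 4.
Proof.
rewrite big_filter.
rewrite (@sum_perms_half 6 Z _ predT [:: 0; 2; 1; 3; 4; 5]%N 1 2) //;
  last 1 first.
- move=> s /perms6P[a [b [c [d [a' [b' ->]]]]]] /=.
  rewrite !(uflag_swap23 e_free _ b) (rel_swap23 e_free a c b).
  by rewrite Z.mul_opp_opp.
rewrite (@sum_perms_half 6 Z _ _ [:: 0; 1; 2; 4; 3; 5]%N 3 4) //;
  last 1 first.
- move=> s /perms6P[a [b [c [d [a' [b' ->]]]]]] /=.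
  by rewrite (Z.mul_comm (uflag _ _ _ _ a')).
by rewrite -!mulrnA.
Qed.

Lemma sym_termE : sym_term =
  (\sum_(s <- pair_perms) pair_term e s
   - \sum_(s <- edge_perms) edge_term e s) *+ 16.
Proof.
rewrite /sym_term big_split /= sumrN sumrMnl sum_pair_term sum_edge_term.
by rewrite mulrnBl -mulrnA.
Qed.

End ReducedSum.

(** * Relabelling, and bit codes of small 3-graphs *)

Definition comp_rel (e : nat -> nat -> nat -> bool) (t : seq nat) i j k :=
  e (nth 0 t i) (nth 0 t j) (nth 0 t k).

Lemma F32_free_comp (T U : Type) (E : T -> T -> T -> bool) (v : U -> T) :
  F32_free_rel E -> F32_free_rel (fun x y z => E (v x) (v y) (v z)).
Proof.
case=> E12 E23 Eirr Efree; split=> // s.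
by rewrite -(Efree (map v s)); case: s => [|? [|? [|? [|? [|? ?]]]]].
Qed.

Lemma sym_term_comp e t : t \in perms 6 ->
  sym_term (comp_rel e t) = sym_term e.
Proof.
move=> tP; rewrite /sym_term -[RHS](sum_perms_arr_l _ tP).
apply: eq_big_seq => s /perms6P[a [b [c [d [a' [b' ->]]]]]].
by [].
Qed.

(** Triples are listed by their largest element first (colexicographic order), so [triples 5] is the
    initial segment of [triples 6]: the first ten bits of a 6-vertex code describe the graph on the
    first five vertices. *)
Definition triples n : seq (nat * nat * nat) :=
  [seq (p, k) | k <- iota 0 n,
                p <- [seq (i, j) | j <- iota 0 k, i <- iota 0 j]].

Definition code_on (ts : seq (nat * nat * nat))
    (e : nat -> nat -> nat -> bool) : seq bool :=
  [seq e p.1.1 p.1.2 p.2 | p <- ts].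

Definition code n := code_on (triples n).

(* A repeated index has rank 20, past the end of a code, so it decodes to
   [false]. *)
Definition rank_table : seq (seq (seq nat)) := Eval vm_compute in
  [seq [seq [seq
    find (fun p => perm_eq [:: i; j; k] [:: p.1.1; p.1.2; p.2]) (triples 6)
    | k <- iota 0 6] | j <- iota 0 6] | i <- iota 0 6].

(** The table depends on [b] alone and is bound outside the function, so it is built once per code
    and not at each query. *)
Definition decode (b : seq bool) : nat -> nat -> nat -> bool :=
  let tab := [seq [seq [seq nth false b r | r <- l] | l <- m] | m <- rank_table]
  in fun i j k => nth false (nth [::] (nth [::] tab i) j) k.

Definition eq_below n (e e' : nat -> nat -> nat -> bool) :=
  forall i j k, i < n -> j < n -> k < n -> e i j k = e' i j k.

Lemma decode_code n e : n <= 6 -> F32_free_rel e ->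
  eq_below n (decode (code n e)) e.
Proof.
move=> n_le6 [e12 e23 eirr _].
have e13 i j k : e i j k = e k j i by rewrite e12 e23 e12.
have eirr1 i j : e i j i = false by rewrite e23.
have eirr2 i j : e j i i = false by rewrite e12.
case: n n_le6 => [|[|[|[|[|[|[|//]]]]]]] _;
  case=> [|[|[|[|[|[|//]]]]]] [|[|[|[|[|[|//]]]]]] [|[|[|[|[|[|//]]]]]] //=
    _ _ _;
  rewrite ?eirr ?eirr1 ?eirr2 //=;
  first [exact: e12 | exact: e23 | exact: e13
        | by rewrite e12 e23 | by rewrite e23 e12].
Qed.

(** * The finite computation on six vertices *)

Definition score_on (pp ep : seq (seq nat)) e : Z :=
  (foldr Z.add 0 [seq pair_term e s | s <- pp]
   - foldr Z.add 0 [seq edge_term e s | s <- ep])%BZ.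

Definition score := score_on pair_perms edge_perms.

Lemma sym_term_score e : F32_free_rel e -> sym_term e = (score e *+ 16)%R.
Proof.
by move=> e_free; rewrite sym_termE // /score /score_on !foldrE !big_map.
Qed.

Lemma perms6_lt s : s \in perms 6 -> exists a b c d a' b',
  s = [:: a; b; c; d; a'; b'] /\
  [&& a < 6, b < 6, c < 6, d < 6, a' < 6 & b' < 6].
Proof.
move=> sP; have [a [b [c [d [a' [b' s_eq]]]]]] := perms6P sP.
exists a, b, c, d, a', b'; split=> //.
by rewrite -!(perms_mem _ sP) s_eq !inE !eqxx !orbT.
Qed.

Lemma eq_score e e' : eq_below 6 e e' -> score e = score e'.
Proof.
move=> eq_e; rewrite /score /score_on.
have [eqA eqB] : {in perms 6, pair_term e =1 pair_term e'} /\
                 {in perms 6, edge_term e =1 edge_term e'}.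
  split=> s /perms6_lt;
    move=> [a [b [c [d [a' [b' [-> /and5P[? ? ? ? /andP[? ?]]]]]]]]] /=.
    by rewrite /kflag /gflag /hflag !eq_e.
  by rewrite /uflag !eq_e.
have -> : [seq pair_term e s | s <- pair_perms] =
          [seq pair_term e' s | s <- pair_perms].
  by apply/eq_in_map => s; rewrite mem_filter => /andP[_ /eqA].
have -> // : [seq edge_term e s | s <- edge_perms] =
             [seq edge_term e' s | s <- edge_perms].
by apply/eq_in_map => s; rewrite mem_filter => /andP[_ /eqB].
Qed.

(** The automorphisms of F32 swap its first two vertices and permute the other three; the order
    conditions keep one placement out of each 12. *)
Definition F32_perms n := [seq s <- perms n |
  [&& lt_at 0 1 s, lt_at 2 3 s & lt_at 3 4 s]].

Definition free_on (ps : seq (seq nat)) e := all (fun s => ~~ has_F32 e s) ps.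

Lemma free_onP n e e' : F32_free_rel e -> eq_below n e' e ->
  free_on (F32_perms n) e'.
Proof.
move=> e_free eq_e; apply/allP=> s; rewrite mem_filter => /andP[_ sP].
have -> : has_F32 e' s = has_F32 e s; last by rewrite (rel_free e_free).
have s_lt : {in s, forall i, i < n} by move=> i; rewrite (perms_mem _ sP).
case: s s_lt {sP} => [|x [|y [|z [|w [|v s]]]]] //= s_lt.
have /and5P[? ? ? ? ?] : [&& x < n, y < n, z < n, w < n & v < n].
  by rewrite !s_lt ?inE ?eqxx ?orbT.
by rewrite !eq_e.
Qed.

Fixpoint bitseqs n : seq (seq bool) :=
  if n is m.+1 then [seq b :: s | b <- [:: true; false], s <- bitseqs m]
  else [:: [::]].

Lemma mem_bitseqs s : s \in bitseqs (size s).
Proof.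
elim: s => //= b s IHs; rewrite cats0 mem_cat.
by case: b; rewrite (map_f (cons _) IHs) ?orbT.
Qed.

(* The F32-free 3-graphs on 5 vertices up to isomorphism; an edge is given by
   its position in [triples 5]. *)
Definition reps5 : seq (seq bool) := [seq [seq i \in r | i <- iota 0 10] | r <-
  [:: [::]; [:: 0]; [:: 0; 7]; [:: 0; 1]; [:: 0; 1; 9]; [:: 0; 1; 5];
      [:: 0; 1; 5; 8]; [:: 0; 1; 5; 8; 9]; [:: 0; 1; 5; 7]; [:: 0; 1; 4];
      [:: 0; 1; 2]; [:: 0; 1; 2; 6]; [:: 0; 1; 2; 6; 8]; [:: 0; 1; 2; 6; 8; 9];
      [:: 0; 1; 2; 4]; [:: 0; 1; 2; 4; 6]; [:: 0; 1; 2; 4; 5];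
      [:: 0; 1; 2; 4; 5; 7]; [:: 0; 1; 2; 3]; [:: 0; 1; 2; 3; 4];
      [:: 0; 1; 2; 3; 4; 5]; [:: 0; 1; 2; 3; 4; 5; 6]]].

(* The [let]s make the reduction machine evaluate each list of permutations
   only once. *)
Lemma reps5_complete :
  let fp := F32_perms 5 in let ps := perms 5 in let rs := reps5 in
  let ts := triples 5 in
  all (fun b => let e := decode b in free_on fp e ==>
    has (fun s => code_on ts (comp_rel e s) \in rs) ps) (bitseqs 10).
Proof. vm_cast_no_check (erefl true). Qed.

(** Each of the 22 representatives is extended by all [2^10] choices of triples through a sixth
    vertex. Up to relabelling this covers every F32-free 3-graph on six vertices, with 22528 codes
    in place of [2^20]. *)
Lemma score_reps5_ge0 :
  let fp := F32_perms 6 in let pp := pair_perms in let ep := edge_perms in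
  all (fun r => all (fun l => let e := decode (r ++ l) in
    free_on fp e ==> (0 <=? score_on pp ep e)%BZ) (bitseqs 10)) reps5.
Proof. vm_cast_no_check (erefl true). Qed.

Lemma sym_term_ge0 e : F32_free_rel e -> (0 <= sym_term e)%R.
Proof.
move=> e_free; have eq5 := decode_code (isT : 5 <= 6) e_free.
have size5 : size (code 5 e) = 10 by rewrite size_map.
have := allP reps5_complete (code 5 e).
rewrite -[in bitseqs 10]size5 mem_bitseqs.
move=> /(_ isT)/implyP/(_ (free_onP e_free eq5))/hasP[s sP s_rep].
have s_lt : {in s, forall i, i < 5} by move=> i; rewrite (perms_mem _ sP).
have size_s := perms_size sP.
(* [s] brings the first five vertices into a representative; [t] extends it by fixing the sixth, and
   [sym_term] does not see the relabelling. *)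
pose t := rcons s 5.
have tP : t \in perms 6.
  rewrite mem_perms /t perm_rcons -[iota 0 6]/(iota 0 5 ++ [:: 5]) cats1.
  by rewrite perm_sym perm_rcons perm_cons perm_sym -mem_perms.
rewrite -(sym_term_comp _ tP).
have e'_free : F32_free_rel (comp_rel e t) by exact: F32_free_comp.
rewrite sym_term_score //; apply: mulrn_wge0.
have := decode_code (leqnn 6) e'_free => /eq_score <-.
pose l := drop 10 (code 6 (comp_rel e t)).
have split6 : code 6 (comp_rel e t) =
    code 5 (comp_rel (decode (code 5 e)) s) ++ l.
  rewrite -[LHS](cat_take_drop 10); congr (_ ++ _).
  rewrite -map_take; apply/eq_in_map => -[[i j] k] ijk /=.
  have /allP/(_ _ ijk)/and3P[i5 j5 k5] : all (fun p : nat * nat * nat =>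
    [&& p.1.1 < 5, p.1.2 < 5 & p.2 < 5]) (triples 5) by [].
  rewrite /comp_rel eq5 ?s_lt ?mem_nth ?size_s //.
  by rewrite !nth_rcons size_s i5 j5 k5.
have := allP score_reps5_ge0 _ s_rep => /allP/(_ l).
cbv zeta; rewrite -split6.
have -> : l \in bitseqs 10.
  by have := mem_bitseqs l; rewrite size_drop size_map.
move=> /(_ isT)/implyP.
move=> /(_ (free_onP e'_free (decode_code (leqnn 6) e'_free))).
exact.
Qed.

(** * Sums over tuples of vertices *)

Section TupleSums.
Local Open Scope ring_scope.
Variables (V : finType) (M : zmodType).

Lemma sum_tupleS n (F : seq V -> M) :
  \sum_(t : n.+1.-tuple V) F t = \sum_x \sum_(t : n.-tuple V) F (x :: t).
Proof.
rewrite pair_big /=.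
rewrite (reindex (fun p : V * n.-tuple V => cons_tuple p.1 p.2)) //=.
exists (fun t => (thead t, behead_tuple t)) => [[x t] _ | t _] /=.
  by congr (_, _); apply: val_inj.
by rewrite [RHS]tuple_eta; apply: val_inj.
Qed.

Lemma sum_tuple0 (F : seq V -> M) : \sum_(t : 0.-tuple V) F t = F [::].
Proof.
rewrite (big_pred1 [tuple]) // => t.
by symmetry; apply/eqP; rewrite [t]tuple0.
Qed.

Definition pull n (t : n.+1.-tuple V) (i : nat) : V := tnth t (inord i).

Lemma sum_tuple_perm n (F : seq V -> M) s : s \in perms n.+1 ->
  \sum_(t : n.+1.-tuple V) F (map (pull t) s) = \sum_(t : n.+1.-tuple V) F t.
Proof.
move=> sP; have size_s := perms_size sP.
pose h (t : n.+1.-tuple V) := tcast size_s (map_tuple (pull t) (in_tuple s)).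
have valh t : h t = map (pull t) s :> seq V by rewrite val_tcast.
rewrite [RHS](reindex h) /=; first by apply: eq_bigr => t _; rewrite valh.
apply/onW_bij/injF_bij => t t' /(congr1 val)/=.
rewrite !valh => /eq_in_map eq_tt'.
apply: eq_from_tnth => i; have := eq_tt' i; rewrite (perms_mem _ sP) ltn_ord.
by move=> /(_ isT); rewrite /pull inord_val.
Qed.

End TupleSums.

(** * The upper bound on the K4^- density *)

Section UpperBound.
Local Open Scope ring_scope.
Variables (V : finType) (E : V -> V -> V -> bool).
Hypothesis E_free : F32_free_rel E.

Notation rel_pull t := (fun i j k => E (pull t i) (pull t j) (pull t k)).

(** Double counting: a 6-tuple pulls [E] back to an F32-free relation on labels, whose [sym_term] is
    nonnegative. After exchanging the sums, each of the 720 orderings contributes the same total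
    over all tuples. *)
Lemma sum_tuple_term_ge0 :
  0 <= \sum_(t : 6.-tuple V) (pair_term E t - edge_term E t *+ 4).
Proof.
have term_pull (t : 6.-tuple V) s : s \in perms 6 ->
    pair_term (rel_pull t) s - edge_term (rel_pull t) s *+ 4 =
    pair_term E (map (pull t) s) - edge_term E (map (pull t) s) *+ 4.
  by case/perms6P => [a [b [c [d [a' [b' ->]]]]]].
have : 0 <= \sum_(t : 6.-tuple V) sym_term (rel_pull t).
  apply: sumr_ge0 => t _; apply: sym_term_ge0.
  exact: (F32_free_comp (pull t) E_free).
rewrite exchange_big /= big_seq.
under eq_bigr => s sP.
  under eq_bigr => t _ do rewrite term_pull //.
  rewrite (sum_tuple_perm (fun s => pair_term E s - edge_term E s *+ 4) sP).
  over.
rewrite -big_seq big_const_seq count_predT iter_addr_0 pmulrn_lge0 => [//|].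
by rewrite /perms size_permutations ?iota_uniq.
Qed.

Definition sum6 (f : V -> V -> V -> V -> V -> V -> Z) : Z :=
  \sum_x \sum_y \sum_z \sum_w \sum_z' \sum_w' f x y z w z' w'.

Lemma eq_sum6 f g : (forall x y z w z' w', f x y z w z' w' = g x y z w z' w') ->
  sum6 f = sum6 g.
Proof.
by move=> eq_fg; do 6!(apply: eq_bigr => ? _); exact: eq_fg.
Qed.

Lemma sum6_tuple (F : seq V -> Z) : \sum_(t : 6.-tuple V) F t =
  sum6 (fun x y z w z' w' => F [:: x; y; z; w; z'; w']).
Proof.
rewrite sum_tupleS; apply: eq_bigr => x _.
rewrite (sum_tupleS _ (fun s => F (x :: s))); apply: eq_bigr => y _.
rewrite (sum_tupleS _ (fun s => F [:: x, y & s])); apply: eq_bigr => z _.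
rewrite (sum_tupleS _ (fun s => F [:: x, y, z & s])); apply: eq_bigr => w _.
rewrite (sum_tupleS _ (fun s => F [:: x, y, z, w & s])).
apply: eq_bigr => z' _.
rewrite (sum_tupleS _ (fun s => F [:: x, y, z, w, z' & s])).
apply: eq_bigr => w' _.
by rewrite (sum_tuple0 (fun s => F [:: x, y, z, w, z', w' & s])).
Qed.

Lemma sum6B f g :
  sum6 (fun x y z w z' w' => f x y z w z' w' - g x y z w z' w') =
  sum6 f - sum6 g.
Proof.
by rewrite /sum6 -sumrB; do 5!(apply: eq_bigr => ? _; rewrite -sumrB).
Qed.

Lemma sum6Z c f : sum6 (fun x y z w z' w' => c * f x y z w z' w') = c * sum6 f.
Proof.
by rewrite /sum6 mulr_sumr; do 5!(apply: eq_bigr => ? _; rewrite mulr_sumr).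
Qed.

Lemma sum_sum_sqr (f : V -> V -> Z) :
  \sum_z \sum_w \sum_z' \sum_w' (f z w * f z' w') =
  (\sum_z \sum_w f z w) ^+ 2.
Proof.
rewrite expr2 mulr_suml; apply: eq_bigr => z _.
rewrite mulr_suml; apply: eq_bigr => w _.
by rewrite mulr_sumr; apply: eq_bigr => z' _; rewrite mulr_sumr.
Qed.

(** For each fixed root [x y] the two copies are independent, so the inner sum is a square. *)
Lemma sum6_sqr_ge0 (f : V -> V -> V -> V -> Z) :
  0 <= sum6 (fun x y z w z' w' => f x y z w * f x y z' w').
Proof.
by do 2!(apply: sumr_ge0 => ? _); rewrite sum_sum_sqr sqr_ge0.
Qed.

Lemma sum_edge_term_ge0 : 0 <= \sum_(t : 6.-tuple V) edge_term E t.
Proof.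
rewrite sum6_tuple; apply: sumr_ge0 => x _; apply: sumr_ge0 => y _.
apply: sumr_ge0 => z _ /=.
case: (E x y z); last by do 3!(rewrite big1 // => ? _).
(* For a fixed root edge the sum is a square; the dummy sixth point gives the factor [#|V|]. *)
have -> : \sum_w \sum_w' \sum_(_v : V)
    (8 * (uflag E x y z w * uflag E x y z w'))%BZ =
    (8%BZ * (\sum_w uflag E x y z w) ^+ 2) *+ #|V|.
  rewrite expr2 mulr_suml mulr_sumr -sumrMnl; apply: eq_bigr => w _.
  rewrite mulr_sumr mulr_sumr -sumrMnl; apply: eq_bigr => w' _.
  by rewrite sumr_const.
by apply: mulrn_wge0; rewrite mulr_ge0 ?sqr_ge0.
Qed.

Definition sum4 : Z := \sum_x \sum_y \sum_z \sum_w kflag E x y z w.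

(** With [n = #|V|], dropping the three sums of squares leaves [384 * sum4 * n^2 <= 162 * n^6].
    Cancelling [6 * n^2] gives the bound; the case [n = 0] is treated apart. *)
Lemma sum_kflag_le : sum4 *+ 64 <= 27%BZ *+ #|V| ^ 4.
Proof.
have [V0|V_gt0] := posnP #|V|.
  rewrite /sum4 big1 ?mul0rn ?mulrn_wge0 // => x.
  by have := card0_eq V0 x.
have := sum_tuple_term_ge0; rewrite sumrB subr_ge0 sumrMnl.
move=> /(le_trans (mulrn_wge0 4 sum_edge_term_ge0)).
rewrite sum6_tuple /=.
rewrite (@eq_sum6 _ (fun x y z w z' w' => 162%BZ - 384%BZ * kflag E z w z' w'
  - 2%BZ * (gflag E x y z w * gflag E x y z' w')
  - 5%BZ * (hflag E x y z w * hflag E x y z' w'))) //.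
rewrite !sum6B !sum6Z subr_ge0.
move=> /(le_trans (mulr_ge0 (isT : 0 <= 5%BZ :> Z) (sum6_sqr_ge0 (hflag E)))).
rewrite subr_ge0.
move=> /(le_trans (mulr_ge0 (isT : 0 <= 2%BZ :> Z) (sum6_sqr_ge0 (gflag E)))).
rewrite subr_ge0.
have -> : sum6 (fun _ _ z w z' w' => kflag E z w z' w') = sum4 *+ #|V| ^ 2.
  by rewrite /sum6 !sumr_const -/sum4 -mulrnA.
have -> : sum6 (fun _ _ _ _ _ _ => 162%BZ) = 162%BZ *+ #|V| ^ 4 *+ #|V| ^ 2.
  by rewrite /sum6 !sumr_const -!mulrnA -expnD !expnS expn0 muln1 !mulnA.
rewrite mulrnAr ler_pMn2r ?expn_gt0 ?V_gt0 //.
rewrite -[162%BZ]/(27%BZ *+ 6 : Z) -mulrnA mulnC mulrnA.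
rewrite (_ : 384%BZ * sum4 = sum4 *+ 64 *+ 6) ?ler_pMn2r //.
by rewrite -mulrnA -mulr_natl.
Qed.

End UpperBound.

(** * 3-graphs as ternary relations *)

Section GraphRelation.
Variables (V : finType) (G : graph3 V).

Definition edge_rel x y z := [set x; y; z]%SET \in edges G.

Lemma edge_card (e : {set V}) : e \in edges G -> #|e| = 3.
Proof. by move=> eG; apply/eqP; move/forall_inP: (edges_card3 G); apply. Qed.

Lemma edge_rel_swap12 x y z : edge_rel x y z = edge_rel y x z.
Proof. by rewrite /edge_rel (finset.setUC [set x]%SET). Qed.

Lemma edge_rel_swap23 x y z : edge_rel x y z = edge_rel x z y.
Proof. by rewrite /edge_rel finset.setUAC. Qed.

Lemma edge_rel_irr x y : edge_rel x x y = false.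
Proof.
apply/negP => /edge_card; rewrite finset.setUid cards2.
by case: (x != y).
Qed.

Lemma edge_rel_neq x y z : edge_rel x y z -> [/\ x != y, x != z & y != z].
Proof.
move=> exyz; split; apply/eqP => eq_xy; move: exyz; rewrite ?eq_xy.
- by rewrite edge_rel_irr.
- by rewrite edge_rel_swap23 edge_rel_irr.
- by rewrite edge_rel_swap12 edge_rel_swap23 edge_rel_irr.
Qed.

(** Any two vertices of F32 share an edge, and edges have three distinct vertices; so five vertices
    passing [has_F32] are distinct and span a genuine copy. *)
Lemma F32_free_edge_rel : free_of (singleton_family F32) G ->
  F32_free_rel edge_rel.
Proof.
move=> G_free; split; [exact: edge_rel_swap12 | exact: edge_rel_swap23
  | exact: edge_rel_irr | move=> s; apply/negP].
case: s => [|x [|y [|z [|w [|v s]]]]] //= /and4P[xyz xyw xyv zwv].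
apply: (G_free F32 erefl).
have [xy xz yz] := edge_rel_neq xyz; have [_ xw yw] := edge_rel_neq xyw.
have [_ xv yv] := edge_rel_neq xyv; have [zw zv wv] := edge_rel_neq zwv.
pose l := [:: x; y; z; w; v].
have l_uniq : uniq l by rewrite /= !inE !negb_or xy xz xw xv yz yw yv zw zv wv.
exists (fun i : 'I_5 => nth x l i); split.
  by move=> i j /eqP; rewrite nth_uniq // => /eqP/val_inj.
have im_triple i j k : i < 5 -> j < 5 -> k < 5 ->
    [set nth x l (m : 'I_5) | m in triple 4 i j k]%SET =
    [set nth x l i; nth x l j; nth x l k]%SET.
  by move=> i5 j5 k5; rewrite /triple !imsetU !imset_set1 !inordK.
by move=> e; rewrite !inE => /orP[/orP[/orP[]|]|] /eqP ->; rewrite im_triple.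
Qed.

End GraphRelation.

(** * Counting induced copies of K4^- *)

Lemma triple_setC1 : [/\ triple 3 0 1 2 = [set~ inord 3]%SET,
  triple 3 0 1 3 = [set~ inord 2]%SET & triple 3 0 2 3 = [set~ inord 1]%SET].
Proof.
by split; apply/setP => i; rewrite !inE -!val_eqE /= !inordK //;
  case: i => [[|[|[|[|?]]]] ?].
Qed.

(** Naming a triple by the vertex it omits turns K4^- into a 4-set with one distinguished vertex,
    the apex 0 common to its three edges. *)
Lemma mem_K4minus_edges (e : {set 'I_4}) :
  (e \in K4minus_edges) = [exists i, (i != ord0) && (e == [set~ i]%SET)].
Proof.
have [e012 e013 e023] := triple_setC1.
rewrite !inE e012 e013 e023; apply/idP/existsP.
  by case/orP => [/orP[]|] e_eq;
    [exists (inord 3)|exists (inord 2)|exists (inord 1)];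
    rewrite e_eq andbT -val_eqE /= inordK.
case=> i /andP[]; case: i => [[|[|[|[|//]]]] lti] // _ /eqP ->;
  by rewrite !(inj_eq (@finset.setC_inj _)) !(inj_eq set1_inj) -!val_eqE /=
    !inordK.
Qed.

Lemma imset_setC1 (aT rT : finType) (f : aT -> rT) i : injective f ->
  (f @: [set~ i] = f @: [set: aT] :\ f i)%SET.
Proof.
move=> f_inj; apply/setP => v; rewrite !inE.
apply/imsetP/andP => [[j ji ->]|[vi /imsetP[j _ v_eq]]].
  by rewrite (inj_eq f_inj) imset_f //; move: ji; rewrite !inE.
by exists j => //; rewrite !inE -(inj_eq f_inj) -v_eq.
Qed.

Section Induces.
Variables (V : finType) (G : graph3 V).
Implicit Types S : {set V}.

Lemma inducesP S : #|S| = 4 -> reflect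
  (exists2 r, r \in S & {in S, forall v, (S :\ v \in edges G) = (v != r)})
  (induces K4minus G S).
Proof.
move=> cardS; apply: (iffP existsP) => [[f /and3P[/injectiveP f_inj]]|].
  move=> /eqP fS /forallP f_edge; exists (f ord0).
    by rewrite -fS imset_f.
  move=> v; rewrite -fS => /imsetP[i _ ->].
  have <- : (f @: [set~ i])%SET = (f @: [set: 'I_4] :\ f i)%SET.
    exact: imset_setC1.
  rewrite -(eqP (f_edge _)) mem_K4minus_edges (inj_eq f_inj).
  apply/existsP/idP => [[j /andP[j0]]|i0]; last by exists i; rewrite i0 eqxx.
  by rewrite (inj_eq (@finset.setC_inj _)) (inj_eq set1_inj) => /eqP ->.
move=> [r rS r_edge].
(* Apex first; the other three vertices of K4^- are interchangeable, so any enumeration of them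
   gives an isomorphism. *)
pose l := r :: enum (S :\ r)%SET.
have size_l : size l = 4.
  by rewrite /=; move: cardS; rewrite (cardsD1 r) rS add1n cardE.
have l_uniq : uniq l by rewrite /= mem_enum !inE eqxx enum_uniq.
have mem_l : l =i S.
  move=> v; rewrite in_cons mem_enum !inE.
  by case: eqVneq => [->|].
pose f : {ffun verts K4minus -> V} := [ffun i : 'I_4 => nth r l i].
have f_inj : injective f.
  by move=> i j /eqP; rewrite !ffunE nth_uniq ?size_l // => /eqP/val_inj.
have fS : (f @: [set: 'I_4])%SET = S.
  apply/eqP; rewrite eqEcard card_imset // cardsT card_ord cardS leqnn andbT.
  apply/fintype.subsetP => _ /imsetP[i _ ->].
  by rewrite -mem_l ffunE mem_nth ?size_l.
exists f; rewrite fS eqxx; apply/and3P; split=> //; first exact/injectiveP.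
apply/forallP => e; apply/eqP.
have [card_e|card_e] := eqVneq #|e| 3; last first.
  apply/idP/idP => [/(edge_card (G := graph_of K4minus))|/edge_card].
    by move/eqP: card_e.
  by rewrite card_imset // => /eqP; rewrite (negPf card_e).
have /cards1P[i eC] : #|~: e| == 1.
  by rewrite cardsCs finset.setCK card_ord card_e.
have -> : e = [set~ i]%SET by rewrite -eC finset.setCK.
have -> : (f @: [set~ i])%SET = (S :\ f i)%SET.
  by rewrite imset_setC1 ?fS.
rewrite r_edge; last by rewrite -fS imset_f.
rewrite mem_K4minus_edges.
have -> : r = f ord0 by rewrite ffunE.
rewrite (inj_eq f_inj); apply/existsP/idP => [[j /andP[j0]]|i0].
  by rewrite (inj_eq (@finset.setC_inj _)) (inj_eq set1_inj) => /eqP ->.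
by exists i; rewrite i0 eqxx.
Qed.

Lemma kflag_induces S x y z w : #|S| = 4 -> induces K4minus G S ->
  uniq [:: x; y; z; w] -> all (mem S) [:: x; y; z; w] ->
  kflag (edge_rel G) x y z w = 1%BZ.
Proof.
move=> cardS /(inducesP cardS)[r rS r_edge] l_uniq l_S.
have S_eq : S = [set x; y; z; w]%SET.
  have sub : [set x; y; z; w]%SET \subset S.
    apply/fintype.subsetP => v; rewrite !inE -!orbA => v_eq.
    by move/allP: l_S => /(_ v); rewrite !inE; apply.
  apply/esym/eqP; rewrite eqEcard sub cardS.
  have /card_uniqP card_l := l_uniq.
  rewrite -[4]card_l subset_leq_card //.
  by apply/fintype.subsetP => v; rewrite !inE -!orbA.
move: l_uniq l_S; rewrite /= !inE !negb_or !andbT -!andbA.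
move=> /and5P[xy xz xw yz /andP[yw zw]] /and4P[xS yS zS wS].
have neqs := (eq_sym y x, eq_sym z x, eq_sym w x, eq_sym z y, eq_sym w y,
  eq_sym w z, negPf xy, negPf xz, negPf xw, negPf yz, negPf yw, negPf zw).
have [Sw Sz Sy Sx] : [/\ S :\ w = [set x; y; z], S :\ z = [set x; y; w],
    S :\ y = [set x; z; w] & S :\ x = [set y; z; w]]%SET.
  rewrite S_eq; split; apply/setP => v; rewrite !inE;
    (set u := (X in _ != X)); case: (eqVneq v u) => [->|_];
    by rewrite /u ?orbF //= !neqs.
rewrite /kflag /edge_rel -Sw -Sz -Sy -Sx !r_edge //.
by move: rS; rewrite S_eq !inE -!orbA => /or4P[] /eqP ->;
  rewrite eqxx /= !neqs.
Qed.

Local Open Scope ring_scope.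

(** Grouping quadruples by their support, each induced K4^- comes from 24 injective quadruples with
    flag value 1, and all remaining quadruples contribute at least 0. *)
Lemma e_count_le_sum4 :
  Z.of_nat (24 * e_count K4minus G) <= sum4 (edge_rel G).
Proof.
pose F (s : seq V) : Z :=
  if s is [:: x; y; z; w] then kflag (edge_rel G) x y z w else 0.
have F_ge0 s : 0 <= F s.
  case: s => [|x [|y [|z [|w [|? ?]]]]] //=; rewrite /kflag.
  by case: (edge_rel G x y z); case: (edge_rel G x y w);
    case: (edge_rel G x z w); case: (edge_rel G y z w).
have -> : sum4 (edge_rel G) = \sum_(t : 4.-tuple V) F t.
  rewrite sum_tupleS; apply: eq_bigr => x _.
  rewrite (sum_tupleS _ (fun s => F (x :: s))); apply: eq_bigr => y _.
  rewrite (sum_tupleS _ (fun s => F [:: x, y & s])); apply: eq_bigr => z _.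
  rewrite (sum_tupleS _ (fun s => F [:: x, y, z & s])); apply: eq_bigr => w _.
  by rewrite (sum_tuple0 (fun s => F [:: x, y, z, w & s])).
rewrite (partition_big (fun t : 4.-tuple V => [set x in t]%SET) predT) //=.
pose good := [set S : {set V} | (#|S| == 4) && induces K4minus G S]%SET.
rewrite (bigID (mem good)) /= -[leLHS]addr0 lerD //; last first.
  by apply: sumr_ge0 => S _; apply: sumr_ge0.
have -> : Z.of_nat (24 * e_count K4minus G) = \sum_(S in good) 24%BZ.
  rewrite sumr_const /e_count.
  have -> : #|verts K4minus| = 4 by rewrite card_ord.
  by rewrite -/good; lia.
apply: ler_sum => S; rewrite inE => /andP[/eqP cardS S_K4].
pose lists := [set t : 4.-tuple V | all (mem S) t & uniq t]%SET.
have list_set t : t \in lists -> [set x in t]%SET == S.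
  rewrite inE => /andP[t_S t_uniq]; rewrite eqEcard cardS; apply/andP; split.
    by apply/fintype.subsetP => v; rewrite inE => /(allP t_S).
  by rewrite cardsE (card_uniqP t_uniq) size_tuple.
rewrite (bigID (mem lists)) /= -[leLHS]addr0 lerD ?sumr_ge0 //.
have -> : 24%BZ = \sum_(t in lists) 1%BZ.
  by rewrite sumr_const card_uniq_tuples cardS.
rewrite [X in _ <= X](eq_bigl (mem lists)) => [|t]; last first.
  by rewrite andb_idl //; exact: list_set.
apply: ler_sum => t; rewrite inE => /andP[t_S t_uniq].
have := size_tuple t.
case: (val t) t_S t_uniq => [|x [|y [|z [|w [|? ?]]]]] //=.
by move=> t_S t_uniq _; rewrite (kflag_induces cardS S_K4).
Qed.

End Induces.

Lemma mulrn_Z (x : Z) k : (x *+ k)%R = (x * Z.of_nat k)%BZ.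
Proof. by elim: k => [|k IHk]; rewrite ?mulr0n ?mulrS ?IHk; lia. Qed.

Lemma ex_num_le n :
  1536 * ex_num K4minus n (singleton_family F32) <= 27 * n ^ 4.
Proof.
rewrite /ex_num; elim/big_ind: _ => [|x y ? ?|G /asboolP G_free] //.
  by rewrite /maxn; case: ifP.
(* The constant 1536 is [24 * 64]: 24 orderings of a 4-set, and the denominator of 27/64. *)
have := sum_kflag_le (F32_free_edge_rel G_free).
have := e_count_le_sum4 G; rewrite card_ord !mulrn_Z; lia.
Qed.

(** * The extremal construction *)

Section Construction.
Variables (n m : nat).

Definition apexes : {set 'I_n} := [set i : 'I_n | i < m]%SET.

Definition split_edges : {set {set 'I_n}} :=
  [set e : {set 'I_n} | (#|e| == 3) && (#|e :&: apexes| == 1)]%SET.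

Lemma split_card3 : [forall e in split_edges, #|e| == 3%N].
Proof. by apply/forall_inP => e; rewrite inE => /andP[]. Qed.

Definition split_graph := Graph3 split_card3.

Lemma split_edge_sum x y z : edge_rel split_graph x y z ->
  (x \in apexes) + (y \in apexes) + (z \in apexes) = 1.
Proof.
move=> exyz; have [xy xz yz] := edge_rel_neq exyz.
move: exyz; rewrite /edge_rel inE => /andP[_ /eqP <-].
rewrite -sum1_card (eq_bigl _ _ (fun v => finset.in_setI v _ _)).
rewrite big_mkcondr -finset.setUA.
rewrite !big_setU1 ?big_set1 ?inE ?negb_or ?xy ?xz ?yz //=.
by rewrite addnA; do 3![case: ifP => _].
Qed.

(** Along each edge the indicators of [apexes] sum to 1. The three edges through the first two
    vertices force equal indicators at the last three, whose sum is then a multiple of 3, yet they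
    form an edge. *)
Lemma split_graph_free : free_of (singleton_family F32) split_graph.
Proof.
move=> _ -> [f [f_inj f_edge]].
have f_sum i j k : triple 4 i j k \in F32_edges ->
    (f (inord i) \in apexes) + (f (inord j) \in apexes)
    + (f (inord k) \in apexes) = 1.
  move=> /f_edge; rewrite /triple !imsetU !imset_set1; exact: split_edge_sum.
have := f_sum 0 1 2; have := f_sum 0 1 3; have := f_sum 0 1 4.
have := f_sum 2 3 4; rewrite ![triple _ _ _ _ \in _]inE !eqxx ?orbT.
move=> /(_ isT) + /(_ isT) + /(_ isT) + /(_ isT); lia.
Qed.

Lemma split_graph_count :
  #|apexes| * 'C(#|~: apexes|, 3) <= e_count K4minus split_graph.
Proof.
pose bases := [set T : {set 'I_n} | T \subset ~: apexes & #|T| == 3]%SET.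
pose join (p : 'I_n * {set 'I_n}) := (p.1 |: p.2)%SET.
rewrite -cards_draws -/bases -cardsX.
have join_apex a T : a \in apexes -> T \in bases ->
    ((a |: T) :&: apexes = [set a])%SET /\ ((a |: T) :\: apexes = T)%SET.
  move=> aA; rewrite inE => /andP[/fintype.subsetP T_base _].
  split; apply/setP => v; rewrite !inE; case: eqVneq => [->|_] /=.
  - by move: aA; rewrite inE.
  - by apply/negP => /andP[/T_base]; rewrite !inE => /negP.
  - move: aA; rewrite inE => a_lt; rewrite a_lt; apply/esym/negP => /T_base.
    by rewrite !inE a_lt.
  - case vT: (v \in T); rewrite ?andbF // andbT.
    by have := T_base _ vT; rewrite !inE.
(* The pair is recovered from the 4-set by intersecting with [apexes] and by removing it. *)
have join_inj : {in finset.setX apexes bases &, injective join}.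
  move=> [a T] [a' T'] /setXP[aA TB] /setXP[aA' TB'] /= eq_join.
  have [aI TD] := join_apex _ _ aA TB; have [aI' TD'] := join_apex _ _ aA' TB'.
  move: aI TD; rewrite -[_ |: T]/(join (a, T)) eq_join aI' TD'.
  by move=> /set1_inj -> ->.
rewrite -(card_in_imset join_inj) /e_count subset_leq_card //.
apply/fintype.subsetP => _ /imsetP[[a T] /setXP[aA TB] ->].
rewrite inE card_ord.
have [aI TD] := join_apex _ _ aA TB.
have aT : a \notin T.
  move: TB; rewrite inE => /andP[/fintype.subsetP T_base _].
  by apply/negP => /T_base; rewrite inE aA.
have cardT : #|T| = 3 by move: TB; rewrite inE => /andP[_ /eqP].
have cardS : #|join (a, T)| = 4 by rewrite cardsU1 aT cardT.
rewrite cardS eqxx; apply/(inducesP _ cardS).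
exists a; first by rewrite !inE eqxx.
move=> v vS; rewrite inE.
have -> : #|join (a, T) :\ v| = 3.
  by move: cardS; rewrite (cardsD1 v) vS add1n => -[].
(* Removing [v] leaves [[set a] :\ v] inside [apexes], a singleton exactly when [v != a]. *)
rewrite eqxx /= finset.setIDAC aI.
have [->|va] := eqVneq v a; first by rewrite finset.setDv cards0.
by rewrite (_ : [set a] :\ v = [set a])%SET ?cards1 //; apply/setP => u;
  rewrite !inE; case: eqVneq => [->|]; rewrite ?(negPf va) ?andbF.
Qed.

Lemma card_apexes : m <= n -> #|apexes| = m.
Proof.
move=> le_mn.
by rewrite -sum1dep_card -(big_ord_widen n (fun=> 1)) // sum1_card card_ord.
Qed.

End Construction.

Lemma ex_num_ge n m : m <= n ->
  m * 'C(n - m, 3) <= ex_num K4minus n (singleton_family F32).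
Proof.
move=> le_mn; have := split_graph_count n m; rewrite [in 'C(_, _)]cardsCs.
rewrite finset.setCK card_ord card_apexes // => /leq_trans; apply.
by apply: leq_bigmax_cond; apply/asboolP; exact: split_graph_free.
Qed.

(** * Explicit bounds and passage to the limit *)

Lemma ffact_ge n k : (n - k.-1) ^ k <= n ^_ k.
Proof.
elim: k n => [//|k IHk] [|n]; first by rewrite exp0n.
rewrite ffactSS expnS leq_mul // ?leq_subr //.
by apply: leq_trans (IHk n); case: k {IHk}.
Qed.

Lemma ffact_le n k : n ^_ k <= n ^ k.
Proof.
elim: k n => [//|k IHk] n; rewrite ffactnS expnS leq_mul //.
apply: leq_trans (IHk _) _.
by case: k {IHk} => // k; rewrite leq_exp2r ?leq_pred.
Qed.

Lemma ex_num_lower n :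
  27 * (n - 3) ^ 4 <= 1536 * ex_num K4minus n (singleton_family F32).
Proof.
pose m := n %/ 4; have le_mn : m <= n by exact: leq_div.
have := ex_num_ge le_mn; rewrite -(leq_pmul2l (isT : 0 < 1536)).
apply: leq_trans.
have le_bin : (n - m - 2) ^ 3 <= 'C(n - m, 3) * 6.
  by have := ffact_ge (n - m) 3; rewrite -bin_ffact.
(* Rounding in [m = n %/ 4] costs little: [4 * m >= n - 3] and [4 * (n - m - 2) >= 3 * (n - 3)]. The
   constant is now [1536 = 4^4 * 6]. *)
apply: (@leq_trans ((4 * m) * (4 * (n - m - 2)) ^ 3)).
  rewrite (_ : 27 * _ = (n - 3) * (3 * (n - 3)) ^ 3); last first.
    by rewrite expnMn [(n - 3) ^ 4]expnS; lia.
  by apply: leq_mul; rewrite ?leq_exp2r //; lia.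
rewrite expnMn (_ : 4 * m * _ = 256 * (m * (n - m - 2) ^ 3)); last by lia.
rewrite (_ : 1536 * _ = 256 * (m * ('C(n - m, 3) * 6))); last by lia.
by rewrite leq_pmul2l // leq_mul.
Qed.

Section Limit.
Local Open Scope classical_set_scope.
Local Open Scope ring_scope.

Lemma ex_ratio_cvg (R : realType) :
  ex_ratio R K4minus (singleton_family F32) @ \oo --> (27%:R / 64%:R : R).
Proof.
rewrite -cvg_shiftS.
(* After the shift, with [N = n.+1], [q n] is [(N - 3) / N]. Since [N ^_ 4] lies between [(N - 3)^4]
   and [N^4], the ratio lies between [27/64 * q^4] and [27/64 * q^-4]. *)
pose q : R^nat := fun n => 1 - 3%:R * harmonic n.
have q1 : q @ \oo --> (1 : R).
  rewrite -[X in _ --> X]subr0 -[X in _ - X](mulr0 (3%:R : R)).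
  by apply: cvgB; [exact: cvg_cst | apply: cvgMr; exact: cvg_harmonic].
have sqr_cvg1 (u : R^nat) : u @ \oo --> (1 : R) ->
    u n ^+ 2 @[n --> \oo] --> (1 : R).
  move=> u1; have : (u \* u) @ \oo --> (1 * 1 : R) by exact: cvgM.
  by rewrite mulr1.
have q4 : q n ^+ 4 @[n --> \oo] --> (1 : R).
  under eq_fun => n do rewrite (exprM _ 2 2).
  exact: sqr_cvg1 (sqr_cvg1 _ q1).
have lower : 27%:R / 64%:R * q n ^+ 4 @[n --> \oo] --> (27%:R / 64%:R : R).
  by rewrite -[X in _ --> X]mulr1; apply: cvgMr.
have upper : 27%:R / 64%:R * (q n ^+ 4)^-1 @[n --> \oo] --> (27%:R / 64%:R : R).
  by rewrite -[X in _ --> X]mulr1 -invr1; apply: cvgMr; apply: cvgV.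
apply: squeeze_cvgr lower upper; near=> n.
have n3 : (3 <= n)%N by near: n; exact: nbhs_infty_ge.
have N_gt0 : 0 < n.+1%:R :> R by rewrite ltr0n.
have D_gt0 : 0 < (n.+1 - 3)%:R :> R by rewrite ltr0n; lia.
have q_eq : q n = (n.+1 - 3)%:R / n.+1%:R.
  by rewrite natrB ?leqW // mulrBl divff ?gt_eqF.
have q4_eq : q n ^+ 4 = (n.+1 - 3)%:R ^+ 4 / n.+1%:R ^+ 4.
  by rewrite q_eq expr_div_n.
have C_eq : 'C(n.+1, 4)%:R = (n.+1 ^_ 4)%:R / 24%:R :> R.
  by rewrite -bin_ffact natrM mulfK // pnatr_eq0.
have F_gt0 : 0 < (n.+1 ^_ 4)%:R :> R by rewrite ltr0n ffact_gt0.
have le_F : ((n.+1 - 3)%:R : R) ^+ 4 <= (n.+1 ^_ 4)%:R.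
  by rewrite -natrX ler_nat (ffact_ge n.+1 4).
have ge_F : (n.+1 ^_ 4)%:R <= (n.+1%:R : R) ^+ 4.
  by rewrite -natrX ler_nat ffact_le.
set ex := ex_num K4minus n.+1 (singleton_family F32).
have ratio_eq : ex_ratio R K4minus (singleton_family F32) n.+1
    = ex%:R * 24%:R / (n.+1 ^_ 4)%:R.
  have card4 : #|verts K4minus| = 4%N by rewrite card_ord.
  by rewrite /ex_ratio card4 C_eq invf_div mulrA.
have ex_le : ex%:R * 24%:R <= 27%:R / 64%:R * n.+1%:R ^+ 4 :> R.
  have := ex_num_le n.+1; rewrite -/ex -(ler_nat R).
  by rewrite (natrM _ 1536) (natrM _ 27) natrX; lra.
have ex_ge : 27%:R / 64%:R * (n.+1 - 3)%:R ^+ 4 <= ex%:R * 24%:R :> R.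
  have := ex_num_lower n.+1; rewrite -/ex -(ler_nat R).
  by rewrite (natrM _ 1536) (natrM _ 27) natrX; lra.
have N4_gt0 : 0 < n.+1%:R ^+ 4 :> R by exact: exprn_gt0.
have D4_gt0 : 0 < (n.+1 - 3)%:R ^+ 4 :> R by exact: exprn_gt0.
rewrite [X in _ <= X <= _]ratio_eq q4_eq invf_div.
rewrite (mulrA _ (_ ^+ 4) (n.+1%:R ^- 4)) (mulrA _ (_ ^+ 4) (_ ^- 4)).
apply/andP; split; apply: ler_pM;
  rewrite ?lef_pV2 ?posrE ?invr_ge0 ?(ltW N4_gt0) ?(ltW F_gt0) ?mulr_ge0 //.
Unshelve. all: by end_near.
Qed.
End Limit.

Local Open Scope classical_set_scope.
Local Open Scope ring_scope.

Theorem theorem2p22 (R : realType) :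
  cvgn (ex_ratio R K4minus (singleton_family F32)) /\
  turan_density R K4minus (singleton_family F32) = 27%:R / 64%:R.
Proof.
split; first exact: cvgP (@ex_ratio_cvg R).
exact: cvg_lim (@ex_ratio_cvg R).
Qed.
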